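(* Let $X$ be a Banach space. Then the following hold. (a) If $X$ is a two-dimensional real Banach space, then $X$ is strictly convex if and only if every nontrivial bounded subset $A \subseteq X$ which contains its Chebyshev center is CCNF. (b) If $X$ is a finite-dimensional Banach space, then $X$ is strictly convex if and only if every nontrivial bounded centerable subset $A \subseteq X$ which contains its Chebyshev center is CCNF. (c) If $X$ is any Banach space, then $X$ is strictly convex if and only if every nontrivial bounded centerable and M-compact subset $A \subseteq X$ which contains its Chebyshev center is CCNF.
   Context: A Banach space $X$ is strictly convex if its unit sphere contains no nontrivial line segment. For a nonempty bounded set $A \subseteq X$ and $x \in X$, put $r(x,A) = \sup_{a \in A}\|x-a\|$ and $F(x,A) = \{a \in A : \|x-a\| = r(x,A)\}$, and let $\mathrm{Far}\,A = \bigcup_{x \in X} F(x,A)$. The Chebyshev radius of $A$ is $r(A) = \inf_{x \in X} r(x,A)$; a point $c \in X$ with $r(c,A) = r(A)$ is called a Chebyshev center of $A$; ''$A$ contains its Chebyshev center'' means that some Chebyshev center of $A$ belongs to $A$. A set is nontrivial if it has at least two elements. $A$ is a CCF set if some Chebyshev center of $A$ belongs to $\mathrm{Far}\,A$, and a CCNF set otherwise. $A$ is centerable if $r(A) = \frac12 \mathrm{diam}(A)$, where $\mathrm{diam}(A) = \sup_{a_1,a_2 \in A}\|a_1-a_2\|$. A sequence $\{a_n\}$ in $A$ is maximizing if for some $x \in X$ one has $\|x-a_n\| \to r(x,A)$; $A$ is M-compact if every maximizing sequence in $A$ has a subsequence converging to an element of $A$. *)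

(* Defs.v *)
From HB Require Import structures.
From mathcomp Require Import all_boot all_order all_algebra.
From mathcomp Require Import complex.
From mathcomp Require Import mathcomp_extra boolp classical_sets functions.
From mathcomp Require Import set_interval reals topology normedtype sequences.

Set Implicit Arguments.
Unset Strict Implicit.
Unset Printing Implicit Defensive.

Import Order.TTheory GRing.Theory Num.Theory.
Import numFieldNormedType.Exports.

Local Open Scope classical_set_scope.
Local Open Scope ring_scope.

(* The scalar field K is meant to be R or R[i] for a realType R.  Norms are
   K-valued and, when K = R[i], nonnegative real elements of K; in the partial
   order of R[i] only numbers with equal imaginary parts are comparable, so
   that [supremum] and [infimum] of a nonempty bounded set of real elements are
   the usual ones, and the interval `[0, 1] is the real unit interval.
   On sets that are empty or have no supremum (infimum), [supremum 0]
   ([infimum 0]) takes the default value 0; all the notions below are meant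
   for nonempty bounded sets. *)
Section ChebyshevCenters.
Context {K : numFieldType} {X : normedModType K}.
Implicit Types (x y c : X) (A : set X).

Definition unit_sphere : set X := [set x | `|x| = 1].

Definition line_segment x y : set X :=
  [set (1 - t) *: x + t *: y | t in `[0, 1]].

Definition farthest_distance x A : K := supremum 0 [set `|x - a| | a in A].

Definition farthest_points x A : set X :=
  [set a | A a /\ `|x - a| = farthest_distance x A].

Definition Far A : set X := \bigcup_(x in setT) farthest_points x A.

Definition chebyshev_radius A : K :=
  infimum 0 [set farthest_distance x A | x in setT].

Definition chebyshev_center A c : Prop :=
  farthest_distance c A = chebyshev_radius A.

Definition contains_chebyshev_center A : Prop :=
  exists2 c, chebyshev_center A c & A c.

Definition nontrivial_set A : Prop := exists a b, [/\ A a, A b & a != b].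

Definition CCF A : Prop := exists2 c, chebyshev_center A c & Far A c.

Definition CCNF A : Prop := ~ CCF A.

Definition diameter A : K := supremum 0 [set `|a1 - a2| | a1 in A & a2 in A].

Definition centerable A : Prop := chebyshev_radius A = diameter A / 2.

Definition maximizing A (a : nat -> X) : Prop :=
  (forall n, A (a n)) /\
  exists x, `|x - a n| @[n --> \oo] --> farthest_distance x A.

Definition M_compact A : Prop := forall a : nat -> X, maximizing A a ->
  exists2 s : nat -> nat, increasing_seq s &
  exists2 l, A l & a (s n) @[n --> \oo] --> l.

End ChebyshevCenters.

Definition strictly_convex (K : numFieldType) (X : normedModType K) : Prop :=
  forall x y : X, x != y -> ~ (line_segment x y `<=` unit_sphere).

Definition has_dimension (K : numFieldType) (n : nat) (X : lmodType K) : Prop :=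
  inhabited (Vector.axiom n X).

Definition finite_dimensional (K : numFieldType) (X : lmodType K) : Prop :=
  exists n, has_dimension n X.

(* Main.v *)
Require Import Defs.
From HB Require Import structures.
From mathcomp Require Import all_boot all_order all_algebra.
From mathcomp Require Import complex.
From mathcomp Require Import mathcomp_extra boolp classical_sets functions.
From mathcomp Require Import set_interval reals topology normedtype sequences.
From mathcomp Require Import cardinality derive interval_inference ring lra.
Import Order.TTheory GRing.Theory Num.Theory.
Import numFieldNormedType.Exports.
Local Open Scope classical_set_scope.
Local Open Scope ring_scope.
Local Open Scope complex_scope.

Set Implicit Arguments.
Unset Strict Implicit.
Unset Printing Implicit Defensive.

(* If the segment [x, y] lies in the unit sphere, then {x, y, (x + y) / 2} is
   a finite centerable set whose center (x + y) / 2 is farthest from 0.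

   Conversely, let X be strictly convex and let A be centerable with a center
   c in A and r(A) = r.  Finite dimension or M-compactness yields a, b in the
   closure of A with |a - b| = diam A = 2 r; both lie in the ball B(c, r), so
   c = (a + b) / 2.  For any x, a and b lie in the ball B(x, r(x, A)), hence c
   lies in its interior and is not farthest from x.

   In the plane, suppose that c in A is a center and is farthest from x.  Then
   A lies in B(c, r) and in B(x, |x - c|).  With z = x - c, choose e such that
   z is Birkhoff orthogonal to e, and u such that e is Birkhoff orthogonal to
   u.  By strict convexity A \ {c} lies strictly on the side of z of the line
   c + R e, and moving c slightly to that side in the direction of u brings it
   closer than r to all of the compact closure of A, contradicting the
   minimality of r. *)

(** * Order and completeness of the scalar field *)

Definition sup_complete (K : numFieldType) : Prop :=
  forall S : set K, S !=set0 -> (forall z, S z -> 0 <= z) -> has_ubound S ->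
  supremums S !=set0.

(** Beyond the structure of [numFieldType], parts (b) and (c) use of the scalars only [sup_complete]
    and, for (b), this property. Both are verified below for [R] and [R[i]], so that the real and
    complex cases share one proof. *)
Definition compact_unit_ball (K : numFieldType) : Prop :=
  compact [set z : K | `|z| <= 1].

Lemma supremum_max {K : numFieldType} (S : set K) (z : K) :
  S z -> ubound S z -> supremum 0 S = z.
Proof.
move=> Sz zS; rewrite /supremum ifF; last by apply/eqP => S0; rewrite S0 in Sz.
apply: (is_subset1_supremums (A := S)); last by split=> // u; exact.
by apply: xgetPex; exists z; split=> // u; exact.
Qed.

Lemma infimum_min {K : numFieldType} (S : set K) (z : K) :
  S z -> lbound S z -> infimum 0 S = z.
Proof.
move=> Sz zS; rewrite /infimum ifF; last by apply/eqP => S0; rewrite S0 in Sz.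
apply: (is_subset1_infimums (A := S)); last by split=> // u; exact.
by apply: xgetPex; exists z; split=> // u; exact.
Qed.

Lemma supremum_ub {K : numFieldType} (S : set K) (z : K) :
  supremums S !=set0 -> S z -> z <= supremum 0 S.
Proof.
move=> supS Sz; rewrite /supremum ifF; last first.
  by apply/eqP => S0; rewrite S0 in Sz.
by have [+ _] := xgetPex 0 supS; exact.
Qed.

Lemma supremum_least {K : numFieldType} (S : set K) (u : K) :
  supremums S !=set0 -> S !=set0 -> ubound S u -> supremum 0 S <= u.
Proof.
move=> supS /set0P/negbTE S0 Su; rewrite /supremum S0.
by have [_ ] := xgetPex 0 supS; exact.
Qed.

(** Otherwise [supremum 0 S - e] would be an upper bound. Nonnegativity makes the elements of [S]
    and the supremum real, so that a failing strict inequality can be reversed although the order of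
    [K] may be partial. *)
Lemma supremum_approx {K : numFieldType} (S : set K) (e : K) :
  S !=set0 -> (forall z, S z -> 0 <= z) -> supremums S !=set0 -> 0 < e ->
  exists2 z, S z & supremum 0 S - e < z.
Proof.
move=> [z0 Sz0] Sge0 supS e0; apply: contrapT => H.
have s0 : 0 <= supremum 0 S.
  by rewrite (le_trans (Sge0 _ Sz0))//; exact: supremum_ub.
suff : supremum 0 S <= supremum 0 S - e.
  by rewrite lerDl oppr_ge0 => /(lt_le_trans e0); rewrite ltxx.
apply: supremum_least => //; first by exists z0.
move=> z Sz; rewrite real_leNgt.
- by apply/negP => ?; apply: H; exists z.
- exact/ger0_real/Sge0.
- by rewrite rpredB// ger0_real// ltW.
Qed.

(** * Strict convexity, farthest distances and diametral pairs *)

Section normed.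
Context {K : numFieldType} {X : normedModType K}.
Implicit Types (x y a b c p : X) (A : set X).

Lemma norm_convex x y (t : K) : 0 <= t <= 1 ->
  `|(1 - t) *: x + t *: y| <= (1 - t) * `|x| + t * `|y|.
Proof.
case/andP=> t0 t1; rewrite (le_trans (ler_normD _ _))// !normrZ.
by rewrite (ger0_norm t0) ger0_norm// subr_ge0.
Qed.

(** If one interior point of the segment had norm at least [rho], convexity of the norm would force
    norm [rho] along the whole segment, and division by [rho] would give a segment in the unit
    sphere. *)
Lemma strictly_convex_lt (scX : strictly_convex X) x y (t rho : K) :
  x != y -> 0 < t < 1 -> `|x| <= rho -> `|y| <= rho ->
  `|(1 - t) *: x + t *: y| < rho.
Proof.
move=> xy /andP[t0 t1] xr yr.
have rho0 : 0 <= rho by rewrite (le_trans _ xr).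
have rhogt0 : 0 < rho.
  rewrite lt_def rho0 andbT; apply: contraNneq xy => r0.
  by move: xr yr; rewrite r0 !normr_le0 => /eqP-> /eqP->.
pose q s := (1 - s) *: x + s *: y.
have q_le (s : K) : 0 <= s <= 1 -> `|q s| <= rho.
  move=> /[dup] /andP[s0 s1] /norm_convex /le_trans; apply.
  have -> : rho = (1 - s) * rho + s * rho by ring.
  by rewrite lerD// ler_wpM2l// subr_ge0.
rewrite real_ltNge ?ger0_real//; apply/negP => rq.
(* As [q t] has norm at least [rho], it cannot be a proper convex combination of two points of the
   ball of which one has norm less than [rho]. *)
have qcvx a b (l : K) : 0 < l < 1 -> `|a| <= rho -> `|b| <= rho ->
    (1 - l) *: a + l *: b = q t -> ~~ (`|a| < rho) && ~~ (`|b| < rho).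
  move=> /andP[l0 l1] ar br ql.
  have l1' : 0 < 1 - l by rewrite subr_gt0.
  have := @norm_convex a b l; rewrite (ltW l0) (ltW l1) ql => /(_ isT).
  move/(le_trans rq) => H; apply/andP; split; apply/negP => lt.
    have : (1 - l) * `|a| + l * `|b| < rho.
      have -> : rho = (1 - l) * rho + l * rho by ring.
      by rewrite ltr_leD// ?ltr_pM2l// ler_pM2l.
    by move/(le_lt_trans H); rewrite ltxx.
  have : (1 - l) * `|a| + l * `|b| < rho.
    have -> : rho = (1 - l) * rho + l * rho by ring.
    by rewrite ler_ltD// ?ltr_pM2l// ler_pM2l.
  by move/(le_lt_trans H); rewrite ltxx.
have q_eq (s : K) : 0 <= s <= 1 -> `|q s| = rho.
  move=> s01; have qs := q_le s s01; case/andP: s01 => s0 s1.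
  apply/eqP; rewrite eq_le qs real_leNgt ?ger0_real//=.
  (* The point [q t] lies between [q s] and [y] if [s < t], and between [x] and [q s] if [t < s];
     the quotients are its positions on these subsegments. *)
  have [st|ts|->] := real_ltgtP (ger0_real s0) (ger0_real (ltW t0)).
  - have s1' : 0 < 1 - s by rewrite subr_gt0 (lt_trans st).
    suff /andP[] : ~~ (`|q s| < rho) && ~~ (`|y| < rho) by [].
    apply: (qcvx (q s) y ((t - s) / (1 - s))) => //.
      by rewrite ltr_pdivrMr// mul1r ltrD2r t1 divr_gt0// subr_gt0.
    rewrite /q scalerDr !scalerA -addrA -scalerDl; congr (_ *: _ + _ *: _);
      field; exact: lt0r_neq0.
  - have s0' : 0 < s := lt_trans t0 ts.
    suff /andP[] : ~~ (`|x| < rho) && ~~ (`|q s| < rho) by [].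
    apply: (qcvx x (q s) (t / s)) => //.
      by rewrite divr_gt0//= ltr_pdivrMr// mul1r.
    rewrite /q scalerDr !scalerA addrA -scalerDl; congr (_ *: _ + _ *: _);
      field; exact: lt0r_neq0.
  - by apply/negP => /(le_lt_trans rq); rewrite ltxx.
apply: (scX (rho^-1 *: x) (rho^-1 *: y)).
  by rewrite (inj_eq (scalerI _))// invr_eq0 gt_eqF.
move=> _ [s /= + <-]; rewrite in_itv/= => s01; rewrite /unit_sphere/=.
rewrite !scalerA ![_ * rho^-1]mulrC -!scalerA -scalerDr normrZ.
by rewrite (q_eq s s01) normfV gtr0_norm// mulVf// gt_eqF.
Qed.

Section farthest.
Hypothesis supK : sup_complete K.

Lemma bounded_norm A : bounded_set A ->
  exists2 M, 0 < M & forall a, A a -> `|a| <= M.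
Proof.
move=> [M [Mreal AM]]; exists (`|M| + 1); first by rewrite ltr_wpDl.
by apply: AM; rewrite (le_lt_trans (real_ler_norm Mreal))// ltrDl ltr01.
Qed.

Lemma has_farthest_distance A p : bounded_set A -> A !=set0 ->
  supremums [set `|p - a| | a in A] !=set0.
Proof.
move=> /bounded_norm[M _ AM] [a0 Aa0]; apply: supK.
- by exists `|p - a0|; exists a0.
- by move=> _ [a _ <-].
- exists (`|p| + M) => _ [a Aa <-].
  by rewrite (le_trans (ler_normB _ _))// lerD2l AM.
Qed.

Lemma has_diameter A : bounded_set A -> A !=set0 ->
  supremums [set `|a1 - a2| | a1 in A & a2 in A] !=set0.
Proof.
move=> /bounded_norm[M _ AM] [a0 Aa0]; apply: supK.
- by exists `|a0 - a0|; exists a0 => //; exists a0.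
- by move=> _ [a _ [b _ <-]].
- exists (M + M) => _ [a Aa [b Ab <-]].
  by rewrite (le_trans (ler_normB _ _))// lerD// AM.
Qed.

Lemma le_farthest_distance A p a : bounded_set A -> A a ->
  `|p - a| <= farthest_distance p A.
Proof.
move=> bA Aa; apply: supremum_ub; last by exists a.
by apply: has_farthest_distance => //; exists a.
Qed.

Lemma le_diameter A a b : bounded_set A -> A a -> A b ->
  `|a - b| <= diameter A.
Proof.
move=> bA Aa Ab; apply: supremum_ub; last by exists a => //; exists b.
by apply: has_diameter => //; exists a.
Qed.

Lemma closure_le_farthest_distance A p a : bounded_set A -> closure A a ->
  `|p - a| <= farthest_distance p A.
Proof.
move=> bA clAa; apply/ler_addgt0Pr => e e0.
have [b [Ab /=]] := clAa _ (nbhsx_ballx a e e0).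
rewrite -ball_normE/= => /ltW abe.
have -> : p - a = (p - b) - (a - b) by rewrite opprB addrA subrK.
by rewrite (le_trans (ler_normB _ _))// lerD// le_farthest_distance.
Qed.

Lemma diameter_approx A (e : K) : A !=set0 -> bounded_set A -> 0 < e ->
  exists a b, [/\ A a, A b & diameter A - e < `|a - b|].
Proof.
move=> A0 bA e0.
have D0 : [set `|a1 - a2| | a1 in A & a2 in A] !=set0.
  by have [a0 Aa0] := A0; exists `|a0 - a0|; exists a0 => //; exists a0.
have Dge0 z : [set `|a1 - a2| | a1 in A & a2 in A] z -> 0 <= z.
  by move=> [a _ [b _ <-]].
have [_ [a Aa [b Ab <-]] d] := supremum_approx D0 Dge0 (has_diameter bA A0) e0.
by exists a, b.
Qed.

(** Membership of [a] and [b] in [A] is replaced by the two distance bounds, so that the lemma also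
    applies to points of the closure. *)
Lemma diametral_pair_CCNF (scX : strictly_convex X) A a b :
  nontrivial_set A -> bounded_set A -> centerable A ->
  (forall p, `|p - a| <= farthest_distance p A) ->
  (forall p, `|p - b| <= farthest_distance p A) ->
  diameter A <= `|a - b| -> CCNF A.
Proof.
move=> [a1 [a2 [Aa1 Aa2 a12]]] bA cA ra rb dab [c cc [x _ [Ac xc]]].
have diam0 : 0 < diameter A.
  by rewrite (lt_le_trans _ (le_diameter bA Aa1 Aa2))// normr_gt0 subr_eq0.
have half : 0 < (2^-1 : K) < 1.
  by rewrite invr_gt0 ltr0n invf_lt1 ?ltr0n// ltr1n.
have halfB : 1 - 2^-1 = 2^-1 :> K by field.
(* Both sides have norm at most [diameter A / 2]. Were they distinct, their average [(a - b) / 2]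
   would have norm less than [diameter A / 2]. *)
have mid : a - c = c - b.
  apply/eqP; apply: contraT => ne.
  have := strictly_convex_lt (rho := diameter A / 2) scX ne half.
  rewrite -[diameter A / 2]cA -cc distrC => /(_ (ra c) (rb c)).
  rewrite halfB -scalerDr addrA subrK normrZ cc cA ger0_norm ?invr_ge0//.
  rewrite mulrC ltr_pM2r ?invr_gt0// => /(le_lt_trans dab).
  by rewrite ltxx.
have ab : x - a != x - b.
  rewrite (inj_eq (addrI _)) eqr_opp -subr_eq0 -normr_gt0.
  exact: lt_le_trans diam0 dab.
(* The average of [x - a] and [x - b] is [x - c], whose norm is thus less than the farthest distance
   from [x], against [xc]. *)
have := strictly_convex_lt scX ab half (ra x) (rb x).
rewrite halfB -scalerDr.
have -> : x - a + (x - b) = 2 *: (x - c).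
  have -> : x - a = (x - c) - (a - c) by rewrite opprB addrA subrK.
  have -> : x - b = (x - c) + (c - b) by rewrite addrA subrK.
  by rewrite mid addrACA addNr addr0 scaler_nat mulr2n.
by rewrite scalerA mulVf ?pnatr_eq0// scale1r xc ltxx.
Qed.

End farthest.
End normed.

(** * The Archimedean property and subsequences *)

Lemma sup_complete_archi {K : numFieldType} (x : K) :
  sup_complete K -> 0 <= x -> exists n : nat, x < n%:R.
Proof.
move=> supK x0; apply: contrapT => H.
pose S := range (fun n => n%:R : K).
have S0 : S !=set0 by exists 0%:R; exists 0%N.
have Sge0 z : S z -> 0 <= z by move=> [n _ <-].
have supS : supremums S !=set0.
  apply: supK => //; exists x => _ [n _ <-].
  rewrite real_leNgt ?ger0_real//; apply/negP => xn; apply: H; by exists n.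
(* Some [n] exceeds the supremum minus 1, so [n + 1] exceeds the supremum. *)
have [_ [n _ <-]] := supremum_approx S0 Sge0 supS ltr01.
rewrite ltrBlDr -[1]/(1%:R) -natrD addn1.
suff : n.+1%:R <= supremum 0 S by move/le_lt_trans => /[apply]; rewrite ltxx.
by apply: supremum_ub => //; exists n.+1.
Qed.

Lemma sup_complete_harmonic {K : numFieldType} (e : K) :
  sup_complete K -> 0 < e -> \forall n \near \oo, n.+1%:R^-1 <= e.
Proof.
move=> supK e0.
have [N eN] : exists N : nat, e^-1 < N%:R.
  by apply: sup_complete_archi; rewrite // invr_ge0 ltW.
exists N => // n /= Nn; rewrite invf_ple ?posrE ?ltr0n//.
by rewrite (le_trans (ltW eN))// ler_nat (leq_trans Nn).
Qed.

Lemma increasing_seq_geq (s : nat -> nat) n : increasing_seq s -> (n <= s n)%N.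
Proof.
move=> /increasing_seqP sS; elim: n => // n IH.
exact: leq_ltn_trans IH (sS n).
Qed.

Lemma increasing_seq_cvg (s : nat -> nat) : increasing_seq s -> s @ \oo --> \oo.
Proof.
move=> s_incr P [N _ NP]; exists N => // n /= Nn.
by apply: NP => /=; rewrite (leq_trans Nn)// increasing_seq_geq.
Qed.

(** * M-compact sets and the three-point counterexample *)

Section normed.
Context {K : numFieldType} {X : normedModType K}.
Implicit Types (x y a b c p : X) (A : set X).

Lemma maximizing_harmonic (supK : sup_complete K) A c (a : nat -> X) :
  bounded_set A -> (forall n, A (a n)) ->
  (forall n, farthest_distance c A - n.+1%:R^-1 <= `|c - a n|) ->
  maximizing A a.
Proof.
move=> bA Aa ca; split=> //; exists c; apply/cvgrPdist_le => e e0.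
apply: filterS (sup_complete_harmonic supK e0) => n; apply: le_trans.
rewrite ger0_norm ?subr_ge0; last exact: le_farthest_distance.
by rewrite lerBlDr -lerBlDl.
Qed.

(** Take pairs whose distance is within [1 / (n + 1)] of the diameter. The diameter is twice the
    farthest distance from [c], so by the triangle inequality both components have distances to [c]
    within [1 / (n + 1)] of the farthest one. Both sequences are therefore maximizing, and
    M-compactness is applied twice. *)
Lemma M_compact_diametral_pair (supK : sup_complete K) A :
  A !=set0 -> bounded_set A -> centerable A -> M_compact A ->
  (exists c, chebyshev_center A c) ->
  exists a b, [/\ A a, A b & diameter A <= `|a - b|].
Proof.
move=> A0 bA cA MA [c cc].
have [f Pf] : {f : nat -> X * X & forall n, [/\ A (f n).1, A (f n).2 &
    diameter A - n.+1%:R^-1 <= `|(f n).1 - (f n).2|]}.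
  apply: (choice (P := fun n (f : X * X) => [/\ A f.1, A f.2 &
    diameter A - n.+1%:R^-1 <= `|f.1 - f.2|])) => n.
  have n0 : 0 < n.+1%:R^-1 :> K by rewrite invr_gt0 ltr0n.
  have [a [b [Aa Ab /ltW d]]] := diameter_approx supK A0 bA n0.
  by exists (a, b).
have rE : farthest_distance c A + farthest_distance c A = diameter A.
  by rewrite cc cA -splitr.
have d1 n : farthest_distance c A - n.+1%:R^-1 <= `|c - (f n).1|.
  have [_ Af2 df] := Pf n.
  rewrite -(lerD2r (farthest_distance c A)) addrAC rE (le_trans df)//.
  have -> : (f n).1 - (f n).2 = (c - (f n).2) - (c - (f n).1).
    by rewrite opprB [LHS]addrC [RHS]addrC addrA subrK addrC.
  by rewrite (le_trans (ler_normB _ _))// addrC lerD2l le_farthest_distance.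
have d2 n : farthest_distance c A - n.+1%:R^-1 <= `|c - (f n).2|.
  have [Af1 _ df] := Pf n.
  rewrite -(lerD2r (farthest_distance c A)) addrAC rE (le_trans df)//.
  have -> : (f n).1 - (f n).2 = (c - (f n).2) - (c - (f n).1).
    by rewrite opprB [LHS]addrC [RHS]addrC addrA subrK addrC.
  by rewrite (le_trans (ler_normB _ _))// lerD2l le_farthest_distance.
have [|s s_incr [a Aa fa]] := MA (fst \o f).
  by apply: (@maximizing_harmonic supK A c) => // n; have [] := Pf n.
have [|t t_incr [b Ab fb]] := MA (snd \o f \o s).
  apply: (@maximizing_harmonic supK A c) => // n; first by have [] := Pf (s n).
  (* Passing to the subsequence keeps the bound [1 / (n + 1)] because [n <= s n]. *)
  rewrite (le_trans _ (d2 (s n)))// lerD2l lerN2 lef_pV2 ?posrE ?ltr0n//.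
  by rewrite ler_nat ltnS increasing_seq_geq.
exists a, b; split=> //.
have fa' : (f (s (t n))).1 @[n --> \oo] --> a.
  exact: cvg_comp (increasing_seq_cvg t_incr) fa.
have /cvgrPdist_le fab :
    (f (s (t n))).1 - (f (s (t n))).2 @[n --> \oo] --> a - b.
  exact: cvgB fa' fb.
apply/ler_addgt0Pr => e e0.
(* One half of [e] pays for the distance to the limit [a - b], the other for the defect of the pair
   from the diameter. *)
have e20 : 0 < e / 2 by rewrite divr_gt0// ltr0n.
have [n [/= n1 n2]] := filter_ex (filterI (fab _ e20)
  (sup_complete_harmonic supK e20)).
have [_ _] := Pf (s (t n)); rewrite lerBlDr => /le_trans; apply.
rewrite [e in leRHS]splitr addrA lerD//.
  by rewrite -lerBlDl (le_trans _ n1)// [leRHS]distrC lerB_dist.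
rewrite (le_trans _ n2)// lef_pV2 ?posrE ?ltr0n// ler_nat ltnS.
exact: leq_trans (increasing_seq_geq n t_incr) (increasing_seq_geq _ s_incr).
Qed.

(** A sequence in a finite set is constant along some subsequence. *)
Lemma finite_M_compact A : finite_set A -> M_compact A.
Proof.
move=> finA a [Aa _].
have /finite_range_cst_subsequence[x [B Boo Bx]] : finite_set (range a).
  by apply: sub_finite_set finA => _ [n _ <-].
have /= [|f [f_incr _ Bf]] := infinite_increasing_seq_wf _ Boo 0%N.
  by move=> n; apply: sub_finite_set (finite_II n.+1) => m /=.
have afx n : a (f n) = x by apply/Bx.
exists f => //; exists x; first by rewrite -(afx 0%N).
by under eq_fun do rewrite afx; exact: cvg_cst.
Qed.

(** A single finite set refutes the right-hand side of all three equivalences. *)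
Lemma not_strictly_convex_CCF (supK : sup_complete K) :
  ~ strictly_convex X -> exists A : set X,
  [/\ nontrivial_set A, bounded_set A, centerable A &
      [/\ M_compact A, contains_chebyshev_center A & CCF A]].
Proof.
move=> /existsNP[x /existsNP[y /not_implyP[xy /contrapT xyS]]].
pose m : X := (1 - 2^-1) *: x + 2^-1 *: y.
have halfB : 1 - 2^-1 = 2^-1 :> K by field.
have sph (t : K) : 0 <= t <= 1 -> `|(1 - t) *: x + t *: y| = 1.
  by move=> t01; apply: (xyS); exists t => //=; rewrite in_itv.
have x1 : `|x| = 1.
  by have := sph 0; rewrite subr0 scale1r scale0r addr0 lexx ler01; exact.
have y1 : `|y| = 1.
  by have := sph 1; rewrite subrr scale1r scale0r add0r lexx ler01; exact.
have m1 : `|m| = 1.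
  by apply: sph; rewrite invr_ge0 ler0n invf_le1 ?ltr0n// ler1n.
have xm : x - m = 2^-1 *: (x - y).
  rewrite /m halfB scalerBr opprD addrA; congr (_ - _).
  by rewrite -{1}(scale1r x) -scalerBl halfB.
have my : m - y = 2^-1 *: (x - y).
  rewrite /m halfB scalerBr -addrA; congr (_ + _); rewrite -[in - y](scale1r y).
  by rewrite -scalerBl -opprB halfB scaleNr.
pose d := `|x - y|.
have xmd : `|x - m| = d / 2.
  by rewrite xm normrZ ger0_norm ?invr_ge0// mulrC.
have myd : `|m - y| = d / 2.
  by rewrite my normrZ ger0_norm ?invr_ge0// mulrC.
have d0 : 0 <= d := normr_ge0 _.
have d20 : 0 <= d / 2 by rewrite divr_ge0.
have d2d : d / 2 <= d by rewrite ler_pdivrMr// ler_peMr// ler1n.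
pose A : set X := [set p | [\/ p = x, p = y | p = m]].
have bA : bounded_set A.
  exists 1; split=> // M /ltW M1 p /=.
  by case=> ->; rewrite ?x1 ?y1 ?m1.
have Ax : A x by constructor 1.
have Ay : A y by constructor 2.
have Am : A m by constructor 3.
have diamA : diameter A = d.
  apply: supremum_max; first by exists x => //; exists y.
  by move=> _ [a [] -> [b [] -> <-]]; rewrite ?subrr ?normr0// ?xmd ?myd //
    distrC -?/d ?xmd ?myd.
have rm : farthest_distance m A = d / 2.
  apply: supremum_max; first by exists x => //; rewrite distrC.
  by move=> _ [a [] -> <-]; rewrite ?subrr ?normr0// ?myd// distrC xmd.
have rA : chebyshev_radius A = d / 2.
  apply: infimum_min; first by exists m.
  (* For every [p], the triangle inequality through [p] bounds [|x - y|] by twice the farthest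
     distance from [p]. *)
  move=> _ [p _ <-]; rewrite ler_pdivrMr// mulr_natr mulr2n.
  have -> : d = `|(p - y) - (p - x)|.
    by rewrite /d opprB [_ + (x - p)]addrC addrA subrK.
  by rewrite (le_trans (ler_normB _ _))// lerD// le_farthest_distance.
have mA : chebyshev_center A m by rewrite /chebyshev_center rm rA.
exists A; split=> //; first by exists x, y.
  by rewrite /centerable rA diamA.
split.
- apply: finite_M_compact.
  apply: (@sub_finite_set _ _ ([set x] `|` [set y] `|` [set m])).
    by move=> p [] ->; [left; left|left; right|right].
  by rewrite !finite_setU; split; [split|]; exact: finite_set1.
- by exists m.
(* All three points have norm 1, so each of them is farthest from 0. *)
- exists m => //; exists 0 => //; split=> //; rewrite sub0r normrN m1.
  apply/esym/supremum_max; first by exists x => //; rewrite sub0r normrN.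
  by move=> _ [a [] -> <-]; rewrite sub0r normrN ?x1 ?y1 ?m1.
Qed.

End normed.

(** * Compactness in finite dimension *)

Section normed.
Context {K : numFieldType} {X : normedModType K}.
Implicit Types (x y a b c p : X) (A : set X).

Lemma compact_closed_ball (cK : compact_unit_ball K) (r : K) : 0 < r ->
  compact [set z : K | `|z| <= r].
Proof.
move=> r0.
rewrite (_ : mkset _ = ( *%R r) @` [set z : K | `|z| <= 1]).
  apply: continuous_compact => //; apply: continuous_subspaceT => z.
  exact: (@scaler_continuous _ K^o).
apply/seteqP; split => [z /= zr|_ [z /= z1 <-]].
  exists (r^-1 * z); last by rewrite mulVKf// gt_eqF.
  by rewrite /= normrM normfV (gtr0_norm r0) ler_pdivrMl// mulr1.
by rewrite normrM gtr0_norm// ler_piMr// ltW.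
Qed.

Lemma ler_coord_norm n (v : 'rV[K]_n) i : `|v ord0 i| <= `|v|.
Proof.
rewrite [leRHS]/Num.norm/= mx_normE -[leLHS]nngE num_le.
exact: (le_bigmax _ (fun ij => `|v ij.1 ij.2|%:nng) (ord0, i)).
Qed.

Lemma row_combination_continuous n (e : 'I_n -> X) :
  continuous (fun v : 'rV[K]_n => \sum_(i < n) v ord0 i *: e i).
Proof.
have coef i (v : 'rV[K]_n) : w ord0 i *: e i @[w --> v] --> v ord0 i *: e i.
  by apply: cvgZ; [exact: coord_continuous|exact: cvg_cst].
suff H (s : seq 'I_n) (v : 'rV[K]_n) : \sum_(i <- s) w ord0 i *: e i @[w --> v]
    --> \sum_(i <- s) v ord0 i *: e i by move=> v; exact: H.
elim: s => [|i s IH]; rewrite ?(big_nil, big_cons).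
  under eq_fun do rewrite big_nil; exact: cvg_cst.
by under eq_fun do rewrite big_cons; exact: cvgD (coef i v) IH.
Qed.

(** The inverse [phi] of a coordinate map is continuous and satisfies [d * |v| <= |phi v|] for some
    [d > 0]. A bounded set thus has bounded coordinates and lies in the [phi]-image of a compact
    polydisc. *)
Lemma finite_dimensional_compact_closure (cK : compact_unit_ball K) A :
  finite_dimensional X -> bounded_set A -> compact (closure A).
Proof.
move=> [n [[v2r v2r_lin [phi v2rK phiK]]]] /bounded_norm[M M0 AM].
have phi_lin (l : K) u v : phi (l *: u + v) = l *: phi u + phi v.
  by apply: (can_inj v2rK); rewrite v2r_lin !phiK.
have phiE v : phi v = \sum_(i < n) v ord0 i *: phi (delta_mx ord0 i).
  pose phi' := GRing.isLinear.Build K 'rV[K]_n X *:%R phi phi_lin.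
  pose Phi : {linear 'rV[K]_n -> X} := HB.pack phi phi'.
  rewrite -[phi]/(Phi : _ -> _) [in LHS](row_sum_delta v) linear_sum.
  by apply: eq_bigr => i _; rewrite linearZ.
have phi_cont : continuous phi.
  rewrite (_ : phi = fun v => \sum_(i < n) v ord0 i *: phi (delta_mx ord0 i)).
    exact: row_combination_continuous.
  exact/funext/phiE.
have cballs (r : K) : 0 < r ->
    compact [set v : 'rV[K]_n | forall i, `|v ord0 i| <= r].
  move=> r0; apply: (@rV_compact K n (fun=> [set z | `|z| <= r])) => _.
  exact: compact_closed_ball.
have cS : compact [set v : 'rV[K]_n | `|v| = 1].
  apply: (subclosed_compact _ (cballs 1 ltr01)); last first.
    by move=> v /= v1 i; rewrite -v1 ler_coord_norm.
  apply: (@preimage_closed _ K Num.norm [set 1]).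
    by move=> v _; exact: norm_continuous.
  apply: accessible_closed_set1; apply: hausdorff_accessible.
  exact: norm_hausdorff.
have cN : closed [set `|phi v| | v in [set v : 'rV[K]_n | `|v| = 1]].
  apply: compact_closed; first exact: norm_hausdorff.
  apply: (@continuous_compact _ _ (Num.norm \o phi)) => //.
  apply: continuous_subspaceT => v.
  apply: continuous_comp; first exact: phi_cont.
  exact: norm_continuous.
have phi0 : phi 0 = 0.
  by have := phi_lin (-1) 0 0; rewrite scaler0 addr0 scaleN1r addNr.
(* The norms of [phi v] over the unit sphere form a closed set that omits 0 by injectivity, hence
   misses a ball around 0, whose radius serves as [d]. *)
have [d /= d0 dN] : exists2 d : K, 0 < d & forall v, `|v| = 1 -> d <= `|phi v|.
  have : (~` [set `|phi v| | v in [set v : 'rV[K]_n | `|v| = 1]]) 0.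
    move=> [v /= v1 /eqP]; rewrite normr_eq0 -phi0 (can_eq phiK) => /eqP v0.
    by move: v1; rewrite v0 normr0 => /eqP; rewrite eq_sym oner_eq0.
  move=> /(conj (closed_openC cN))/open_nbhs_nbhs/nbhs_ballP[d /= d0 dN].
  exists d => // v v1; rewrite real_leNgt ?ger0_real// ?ltW//; apply/negP => lt.
  apply: (dN `|phi v|); last by exists v.
  by rewrite -ball_normE/= sub0r normrN normr_id.
have dphi (v : 'rV[K]_n) : d * `|v| <= `|phi v|.
  have [->|v0] := eqVneq v 0; first by rewrite normr0 mulr0.
  have nv0 : 0 < `|v| by rewrite normr_gt0.
  have := dN (`|v|^-1 *: v).
  rewrite normrZ normfV normr_id mulVf ?gt_eqF// => /(_ erefl).
  rewrite -[_ *: v]addr0 phi_lin phi0 addr0 normrZ normfV normr_id.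
  by rewrite ler_pdivlMl// mulrC.
have cC : compact (phi @` [set v : 'rV[K]_n | forall i, `|v ord0 i| <= M / d]).
  apply: continuous_compact; first exact: continuous_subspaceT.
  by apply: cballs; rewrite divr_gt0.
apply: (subclosed_compact _ cC); first exact: closed_closure.
rewrite [X in _ `<=` X](closure_id _).1; last first.
  by apply: compact_closed => //; exact: norm_hausdorff.
apply: closureS => p /AM pM; exists (v2r p); last by rewrite v2rK.
move=> i /=; rewrite (le_trans (ler_coord_norm _ _))// ler_pdivlMr// mulrC.
by rewrite (le_trans (dphi _))// v2rK.
Qed.

(** The distances between points of the closure form a compact, hence closed, set, and the diameter
    is a limit of its elements. *)
Lemma compact_diametral_pair (supK : sup_complete K) A :
  A !=set0 -> bounded_set A -> compact (closure A) ->
  exists a b, [/\ closure A a, closure A b & diameter A <= `|a - b|].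
Proof.
move=> A0 bA cA.
have cE : closed [set `|p.1 - p.2| | p in closure A `*` closure A].
  apply: compact_closed; first exact: norm_hausdorff.
  apply: continuous_compact; last exact: compact_setX.
  apply: continuous_subspaceT => p.
  apply: (@continuous_comp _ _ _ (fun p : X * X => p.1 - p.2) Num.norm).
    by apply: cvgB; [exact: cvg_fst|exact: cvg_snd].
  exact: norm_continuous.
have : closure [set `|p.1 - p.2| | p in closure A `*` closure A] (diameter A).
  move=> B /nbhs_ballP[e /= e0 eB].
  have [a [b [Aa Ab de]]] := diameter_approx supK A0 bA e0.
  exists `|a - b|; split.
    by exists (a, b) => //; split; exact: subset_closure.
  apply: eB; rewrite -ball_normE/= ger0_norm.
    by rewrite ltrBlDr -ltrBlDl.
  by rewrite subr_ge0 le_diameter.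
rewrite -(closure_id _).1// => -[[a b] /= [Aa Ab] abE].
by exists a, b; rewrite abE.
Qed.

End normed.

(** * The scalar fields [R] and [R[i]] *)

Lemma real_sup_complete (R : realType) : sup_complete R.
Proof.
move=> S S0 _ ubS; exists (sup S); split; first exact: ub_le_sup.
by move=> u; exact: ge_sup.
Qed.

Lemma real_compact_unit_ball (R : realType) : compact_unit_ball R.
Proof.
rewrite /compact_unit_ball (_ : mkset _ = `[-1, 1]%classic).
  exact: segment_compact.
by apply/seteqP; split => z /=; rewrite in_itv/= ler_norml.
Qed.

(** Nonnegative elements of [R[i]] and their upper bounds are real, so the supremum of the real
    parts serves. *)
Lemma complex_sup_complete (R : realType) : sup_complete R[i].
Proof.
move=> S [z0 Sz0] Sge0 [u uS].
have SE z : S z -> z = (complex.Re z)%:C by move=> /Sge0/ger0_real/RRe_real.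
have S0 : @complex.Re R @` S !=set0 by exists (complex.Re z0); exists z0.
have uE w : ubound S w -> w = (complex.Re w)%:C.
  move=> wS; apply/esym/RRe_real/ger0_real.
  exact: le_trans (Sge0 _ Sz0) (wS _ Sz0).
have ReS w : ubound S w -> ubound (@complex.Re R @` S) (complex.Re w).
  by move=> wS _ [z Sz <-]; rewrite -lecR -(SE _ Sz) -(uE _ wS); exact: wS.
exists (sup (@complex.Re R @` S))%:C; split=> [z Sz|w wS].
  rewrite (SE _ Sz) lecR; apply: ub_le_sup; last by exists z.
  by exists (complex.Re u); exact: ReS.
by rewrite (uE _ wS) lecR; apply: ge_sup => //; exact: ReS.
Qed.

(** The unit disc is a closed subset of the continuous image of the square of side [[-1, 1]]. *)
Lemma complex_compact_unit_ball (R : realType) : compact_unit_ball R[i].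
Proof.
pose K : numFieldType := R[i].
pose f (p : R * R) : K := Complex p.1 p.2.
have normf (a b : R) : `|Complex a b : K| <= (`|a| + `|b|)%:C.
  rewrite normc_def lecR /= -[leRHS]ger0_norm ?addr_ge0// -sqrtr_sqr.
  rewrite ler_wsqrtr// sqrrD !real_normK ?num_real//.
  by rewrite addrAC lerDl mulrn_wge0// mulr_ge0.
have f_cont : continuous f.
  move=> p; apply/cvgrPdist_lt => e e0.
  have eE : e = (complex.Re e)%:C by rewrite RRe_real// ger0_real// ltW.
  have d0 : 0 < complex.Re e / 2 by rewrite divr_gt0// -ltcR -eE.
  have /cvgrPdist_lt/(_ _ d0) p1 : q.1 @[q --> p] --> p.1 by exact: cvg_fst.
  have /cvgrPdist_lt/(_ _ d0) p2 : q.2 @[q --> p] --> p.2 by exact: cvg_snd.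
  apply: filterS2 p1 p2 => q q1 q2.
  rewrite (le_lt_trans (normf (p.1 - q.1) (p.2 - q.2)))// eE ltcR.
  by rewrite [ltRHS]splitr ltrD.
have cI : compact (`[-1, 1]%classic : set R) := @segment_compact _ _ _.
apply: (subclosed_compact _ (continuous_compact (continuous_subspaceT f_cont)
   (compact_setX cI cI))).
  rewrite (_ : mkset _ = ~` [set z : K | 1 < `|z|]); last first.
    by apply/seteqP; split=> z /=; rewrite real_leNgt ?ger0_real// => /negP.
  apply: open_closedC; rewrite openE => z /= z1.
  apply/nbhs_ballP; exists (`|z| - 1) => /=; first by rewrite subr_gt0.
  move=> w; rewrite -ball_normE/= ltrBrDl -ltrBrDr => /lt_le_trans; apply.
  by rewrite lerBlDr addrC -lerBlDr lerB_dist.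
move=> [a b] /= z1; exists (a, b) => //=.
have z2 : a ^+ 2 + b ^+ 2 <= 1.
  move: z1; rewrite normc_def lecR /= => z1.
  rewrite -(sqr_sqrtr (addr_ge0 (sqr_ge0 a) (sqr_ge0 b))).
  by rewrite exprn_ile1 ?sqrtr_ge0.
split; rewrite /= in_itv/= -ler_norml -[leRHS](ger0_norm (@ler01 R)).
  rewrite -ler_sqr ?nnegrE// !real_normK ?num_real// expr1n.
  by rewrite (le_trans _ z2)// lerDl sqr_ge0.
rewrite -ler_sqr ?nnegrE// !real_normK ?num_real// expr1n.
by rewrite (le_trans _ z2)// lerDr sqr_ge0.
Qed.

(** * Birkhoff orthogonality in a real plane *)

Section plane.
Context {R : realType} {X : normedModType R}.
Implicit Types (x y w a b c p : X) (A : set X).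

(* One step of the Hahn-Banach extension: [sigma] below is the value at [w] of
   a functional on span(x, w) bounded by the norm and equal to [`|x|] at [x],
   and [w - s *: x] lies in its kernel. *)
Lemma exists_orthogonal x w :
  exists s : R, forall l m : R, `|l| * `|x| <= `|l *: x + m *: (w - s *: x)|.
Proof.
have [->|x0] := eqVneq x 0; first by exists 0 => l m; rewrite normr0 mulr0.
have nx0 : `|x| != 0 by rewrite normr_eq0.
pose S := range (fun l : R => l * `|x| - `|l *: x - w|).
(* This is the triangle inequality for [(l *: x - w) + (m *: x + w)]; it leaves room for [sigma]
   between the two families of bounds. *)
have S_le (l m : R) : l * `|x| - `|l *: x - w| <= `|m *: x + w| - m * `|x|.
  rewrite lerBlDr addrAC lerBrDr -mulrDl (le_trans _ (ler_normD _ _))//.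
  rewrite addrACA [w - w]subrr addr0 -scalerDl normrZ addrC.
  by rewrite ler_wpM2r// ler_norm.
have S0 : S !=set0 by exists (0 * `|x| - `|0 *: x - w|); exists 0.
have ubS m : ubound S (`|m *: x + w| - m * `|x|) by move=> _ [l _ <-].
pose sigma := sup S.
have sigma_ge (l : R) : l * `|x| - `|l *: x - w| <= sigma.
  by apply: ub_le_sup; [exists (`|0 *: x + w| - 0 * `|x|); exact: ubS|exists l].
have sigma_le (m : R) : sigma <= `|m *: x + w| - m * `|x| by exact: ge_sup.
(* The functional is bounded by the norm: dividing by [|m|] reduces the claim to the lower bound on
   [sigma] if [m < 0] and to the upper one if [m > 0]. *)
have F (l m : R) : l * `|x| + m * sigma <= `|l *: x + m *: w|.
  have [m0|m0|->] := ltgtP m 0.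
  - have k0 : 0 < - m by rewrite oppr_gt0.
    have := sigma_ge (l / - m); rewrite -(ler_pM2l k0).
    have -> : l / - m *: x - w = (- m)^-1 *: (l *: x + m *: w).
      rewrite scalerDr !scalerA invrN !mulNr mulVf ?lt_eqF// scaleN1r.
      by rewrite mulrN [m^-1 * l]mulrC.
    rewrite normrZ normfV (gtr0_norm k0) mulrBr mulVKf ?gt_eqF//.
    rewrite [- m * (_ / _ * _)]mulrCA mulrA divfK ?gt_eqF//.
    lra.
  - have := sigma_le (l / m); rewrite -(ler_pM2l m0).
    have -> : (l / m) *: x + w = m^-1 *: (l *: x + m *: w).
      by rewrite scalerDr !scalerA mulVf ?gt_eqF// scale1r mulrC.
    rewrite normrZ normfV (gtr0_norm m0) mulrBr mulVKf ?gt_eqF//.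
    rewrite [m * (_ / _ * _)]mulrA [m * (_ / _)]mulrC divfK ?gt_eqF//.
    lra.
  - by rewrite mul0r scale0r !addr0 normrZ ler_wpM2r// ler_norm.
exists (sigma / `|x|) => l m.
have comb (l' m' : R) : l' *: x + m' *: (w - (sigma / `|x|) *: x) =
    (l' - m' * (sigma / `|x|)) *: x + m' *: w.
  by rewrite scalerBr scalerBl scalerA addrA addrAC.
have F' (l' m' : R) : l' * `|x| <=
    `|l' *: x + m' *: (w - (sigma / `|x|) *: x)|.
  rewrite comb (le_trans _ (F _ _))// mulrBl -mulrA divfK//.
  by rewrite subrK.
have [l0|l0] := leP 0 l; first by rewrite ger0_norm.
by rewrite ltr0_norm// (le_trans (F' (- l) (- m)))// !scaleNr -opprD normrN.
Qed.

Hypothesis dimX : has_dimension 2 X.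

Let plane_coordinates : exists c : {linear X -> 'rV[R]_2},
  injective c /\ forall v, exists p, c p = v.
Proof.
have [[c c_lin [phi cK phiK]]] := dimX.
pose C : {linear X -> 'rV[R]_2} :=
  HB.pack c (GRing.isLinear.Build R X 'rV[R]_2 *:%R c c_lin).
by exists C; split=> [|v]; [exact: can_inj cK|exists (phi v)].
Qed.

(** If coordinate [i] of [x] is nonzero and [j] is the other index, the [j]-th basis vector serves
    as [w]: coordinate [i] of [p] determines [l], and coordinate [j] then determines [m]. *)
Lemma plane_complement x : x != 0 ->
  exists w, forall p, exists l m : R, p = l *: x + m *: w.
Proof.
have [c [c_inj c_surj]] := plane_coordinates; move=> x0.
have [i xi] : exists i, c x 0 i != 0.
  apply/existsP; apply: contraNT x0; rewrite negb_exists => /forallP cx0.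
  apply/eqP/c_inj; rewrite linear0; apply/rowP => i; rewrite mxE.
  by apply/eqP; have := cx0 i; rewrite negbK.
have [j ij ijP] : exists2 j : 'I_2, i != j & forall k, (k == i) || (k == j).
  by exists (rev_ord i) => [|k]; case: i {xi} => -[|[|//]] ?;
    [..|case: k => -[|[|//]] ?|case: k => -[|[|//]] ?].
have [w cw] := c_surj (delta_mx 0 j).
exists w => p; pose l := c p 0 i / c x 0 i.
exists l, (c p 0 j - l * c x 0 j); apply: c_inj.
rewrite linearP [c (_ *: w)]linearZ cw.
apply/rowP => k; rewrite !mxE eqxx /=.
have /orP[/eqP->|/eqP->] := ijP k.
  by rewrite (negbTE ij) mulr0 addr0 /l divfK.
by rewrite eqxx mulr1 addrC subrK.
Qed.

Lemma plane_not_line x : exists p, forall l : R, p != l *: x.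
Proof.
have [c [c_inj c_surj]] := plane_coordinates.
apply: contrapT => H.
have line p : exists l : R, p = l *: x.
  apply: contrapT => Hp; apply: H; exists p => l; apply/eqP => pl.
  by apply: Hp; exists l.
have [p cp] := c_surj (delta_mx 0 0); have [q cq] := c_surj (delta_mx 0 1).
have [l pl] := line p; have [m qm] := line q.
move: cp cq; rewrite pl qm !linearZ => /rowP cp /rowP cq.
move: (cp 0) (cp 1) (cq 0) (cq 1); rewrite !mxE /= => l1 l0 m0 m1.
have /eqP := l0; rewrite mulf_eq0 => /orP[] /eqP H0.
  by move: l1; rewrite H0 mul0r => /esym/eqP; rewrite oner_eq0.
by move: m1; rewrite H0 mulr0 => /esym/eqP; rewrite oner_eq0.
Qed.

(** The second clause is Birkhoff orthogonality of [x] to [e] in homogeneous form. *)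
Lemma plane_orthogonal x : x != 0 -> exists e,
  (forall p, exists l m : R, p = l *: x + m *: e) /\
  (forall l m : R, `|l| * `|x| <= `|l *: x + m *: e|).
Proof.
move=> x0; have [w xw] := plane_complement x0.
have [s xs] := exists_orthogonal x w; exists (w - s *: x); split=> // p.
have [l [m ->]] := xw p; exists (l + m * s), m.
by rewrite scalerBr scalerDl scalerA addrA addrAC addrK.
Qed.

(** Here [z] stands for [x - c] and [p] for a point of the set minus [c]. The direction [v] is the
    component along [u] of [z] in the basis [e], [u]. The step [t] may depend on [p]; compactness
    makes it uniform later. *)
Lemma plane_shrinking_direction (scX : strictly_convex X) (z : X) (r : R) :
  z != 0 -> 0 < r -> exists v, forall p, `|p| <= r -> `|z - p| <= `|z| ->
  exists2 t : R, 0 < t & `|p - t *: v| < r.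
Proof.
move=> z0 r0.
have half : 0 < (2^-1 : R) < 1.
  by rewrite invr_gt0 ltr0n invf_lt1 ?ltr0n// ltr1n.
have [e [ze zs]] := plane_orthogonal z0.
have e0 : e != 0.
  have [p pz] := plane_not_line z; have [l [m pE]] := ze p.
  by apply: contraNneq (pz l) => e0; rewrite pE e0 scaler0 addr0.
have [u [eu es]] := plane_orthogonal e0.
have [g [d zE]] := eu z.
(* Otherwise [z = g *: e], and orthogonality of [z] to [e] would give [|z| <= |z - g *: e| = 0]. *)
have du0 : d *: u != 0.
  apply: contraNneq z0 => du0; have := zs 1 (- g).
  rewrite [in leRHS]zE du0 addr0 scale1r scaleNr subrr normr0 normr1 mul1r.
  by rewrite normr_le0.
exists (d *: u) => p pr zp.
have [->|p0] := eqVneq p 0.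
  exists (r / 2 / (1 + `|d *: u|)).
    by rewrite !divr_gt0// ltr_wpDr.
  rewrite sub0r normrN normrZ ger0_norm; last first.
    by rewrite !divr_ge0// ?ltW// addr_ge0.
  rewrite mulrAC ltr_pdivrMr ?ltr_wpDr//.
  have := normr_ge0 (d *: u); nra.
have [l [m pE]] := ze p.
(* If [l <= 0], orthogonality gives [|z| <= |z - k *: p|] for all [k >= 0]. At [k = 1/2] this
   contradicts strict convexity, as [z] and [z - p] are distinct points of the ball of radius
   [|z|]. *)
have l0 : 0 < l.
  rewrite ltNge; apply/negP => l0.
  have zle (k : R) : 0 <= k -> `|z| <= `|z - k *: p|.
    move=> k0; have := zs (1 - k * l) (- (k * m)).
    rewrite scaleNr scalerBl scale1r -addrA -opprD -!scalerA -scalerDr -pE.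
    apply: le_trans; rewrite ler_peMl// ger0_norm; last by nra.
    by nra.
  have ne : z != z - p.
    by rewrite -[X in X != _]subr0 (inj_eq (addrI _)) eqr_opp eq_sym.
  have := strictly_convex_lt scX ne half (lexx _) zp.
  rewrite ltNge; apply/negP/negPn.
  rewrite scalerBr addrA -scalerDl subrK scale1r.
  by apply: zle; rewrite invr_ge0.
have pu : p - l *: (d *: u) = (l * g + m) *: e.
  by rewrite pE {1}zE scalerDr scalerA scalerDl addrAC addrK.
exists (l / 2); first by rewrite divr_gt0.
(* Subtracting [l *: v] removes the [u]-component of [p], which does not increase the norm because
   [e] is orthogonal to [u]. The midpoint of [p] and [p - l *: v] then has norm less than [r], which
   explains [t = l / 2]. *)
have pu_r : `|p - l *: (d *: u)| <= r.
  rewrite pu normrZ (le_trans (es _ (l * d)))// -pu -scalerA subrK.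
  exact: pr.
have ne : p != p - l *: (d *: u).
  rewrite -[X in X != _]subr0 (inj_eq (addrI _)) eqr_opp eq_sym.
  by rewrite scaler_eq0 negb_or gt_eqF.
have := strictly_convex_lt scX ne half pr pu_r.
rewrite scalerBr addrA -scalerDl subrK scale1r.
by rewrite [2^-1 *: _]scalerA [2^-1 * l]mulrC.
Qed.

End plane.

(** * The planar case: a uniform displacement of the center *)

Lemma plane_CCNF (R : realType) (X : normedModType R) (A : set X) :
  has_dimension 2 X -> strictly_convex X -> nontrivial_set A -> bounded_set A ->
  CCNF A.
Proof.
move=> dimX scX [a1 [a2 [Aa1 Aa2 a12]]] bA [c cc [x _ [Ac xc]]].
have supR := @real_sup_complete R.
have A0 : A !=set0 by exists a1.
set r := farthest_distance c A.
have r_ge p : closure A p -> `|p - c| <= r.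
  by move=> Ap; rewrite distrC; exact: closure_le_farthest_distance.
have subA := @subset_closure _ A.
have r0 : 0 < r.
  rewrite lt_def (le_trans _ (r_ge _ (subA _ Ac)))// andbT.
  apply: contraNneq a12 => r0.
  move: (r_ge _ (subA _ Aa1)) (r_ge _ (subA _ Aa2)).
  by rewrite r0 !normr_le0 !subr_eq0 => /eqP -> /eqP ->.
have zx p : closure A p -> `|(x - c) - (p - c)| <= `|x - c|.
  move=> Ap; rewrite opprB addrA subrK xc.
  exact: closure_le_farthest_distance.
have z0 : x - c != 0.
  apply: contraNneq a12 => z0; move: (zx _ (subA _ Aa1)) (zx _ (subA _ Aa2)).
  by rewrite z0 normr0 !normr_le0 !sub0r !oppr_eq0 !subr_eq0 => /eqP -> /eqP ->.
have [v Pv] := plane_shrinking_direction dimX scX z0 r0.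
have cA : compact (closure A).
  apply: finite_dimensional_compact_closure => //; last by exists 2%N.
  exact: real_compact_unit_ball.
(* The step [t0] found for [p] works for all [q] close to [p]. By convexity so does every [t] in
   []0, t0[], since the norm at [t = 0] is at most [r]. Compactness of the closure then gives one
   [t] for all points. *)
have : \forall t \near (0 : R)^'+,
    closure A `<=` (fun p => `|p - c - t *: v| < r).
  move/compact_near_coveringP/near_covering_withinP : (cA); apply => p Ap.
  have [t0 t00 pt0] := Pv _ (r_ge _ Ap) (zx _ Ap).
  have d0 : 0 < r - `|p - c - t0 *: v| by rewrite subr_gt0.
  exists (ball p (r - `|p - c - t0 *: v|), [set t | 0 < t < t0]) => /=.
    split; first exact: nbhsx_ballx.
    near=> t; apply/andP; split; near: t.
      exact: nbhs_right_gt.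
    exact: nbhs_right_lt.
  move=> [q t] /= [+ /andP[tgt0 tt0]] Aq; rewrite -ball_normE/= => pq.
  have qt0 : `|q - c - t0 *: v| < r.
    have -> : q - c - t0 *: v = (p - c - t0 *: v) - (p - q).
      by rewrite opprB [RHS]addrC !addrA subrK.
    by rewrite (le_lt_trans (ler_normB _ _))// -ltrBrDl.
  have l01 : 0 < t / t0 < 1.
    by rewrite divr_gt0//= ltr_pdivrMr// mul1r.
  have -> : q - c - t *: v =
      (1 - t / t0) *: (q - c) + (t / t0) *: (q - c - t0 *: v).
    rewrite [(t / t0) *: _]scalerBr scalerA divfK ?gt_eqF//.
    by rewrite addrA -scalerDl subrK scale1r.
  case/andP: l01 => l0 l1.
  rewrite (le_lt_trans (norm_convex _ _ _)) ?(ltW l0) ?(ltW l1)//.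
  have := r_ge _ Aq; nra.
move=> /(filterI (nbhs_right_gt 0))/filter_ex[t [_ At]].
(* The maximum over the closure is attained, so the strict pointwise bound survives passage to the
   supremum. *)
have [||q Aq qmax] := @compact_EVT_max _ _ (fun p => `|p - c - t *: v|) _ _ cA.
- by exists c; exact: subA.
- apply: continuous_subspaceT => p.
  apply: (@continuous_comp _ _ _ (fun p => p - c - t *: v) Num.norm).
    by apply: cvgB; [apply: cvgB => //; exact: cvg_cst|exact: cvg_cst].
  exact: norm_continuous.
have : farthest_distance (c + t *: v) A < r.
  apply: (@le_lt_trans _ _ `|q - c - t *: v|); last by apply: At; rewrite -inE.
  apply: supremum_least.
  - exact: has_farthest_distance.
  - by exists `|c + t *: v - a1|; exists a1.
  - move=> _ [a Aa <-]; rewrite distrC opprD addrA; apply: qmax.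
    by rewrite inE; exact: subA.
rewrite ltNge => /negP; apply; rewrite /r cc.
(* Boundedness below by 0 ensures that the radius is a true infimum and not the default value. *)
have lbr : lbound [set farthest_distance y A | y in setT] 0.
  move=> _ [y _ <-]; apply: le_trans (le_farthest_distance supR y bA Ac).
  exact: normr_ge0.
rewrite /chebyshev_radius; apply: le_infimum_Nmem; last by exists (c + t *: v).
exists (inf [set farthest_distance y A | y in setT]); split.
  by apply: ge_inf; exists 0.
by move=> y; apply: lb_le_inf; exists (farthest_distance c A); exists c.
Unshelve. all: by end_near. Qed.

(** * The equivalences over a general scalar field and their instances *)

Section characterizations.
Context {K : numFieldType} {X : normedModType K}.
Hypothesis supK : sup_complete K.

Lemma finite_dimensional_strictly_convexP : compact_unit_ball K ->
  finite_dimensional X ->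
  (strictly_convex X <->
   forall A : set X, nontrivial_set A -> bounded_set A -> centerable A ->
     contains_chebyshev_center A -> CCNF A).
Proof.
move=> cK dimX; split=> [scX A ntA bA cA _|H]; last first.
  apply: contrapT => /(not_strictly_convex_CCF supK).
  move=> [A [ntA bA cA [_ chA ccfA]]]; exact: H ccfA.
have A0 : A !=set0 by have [a [b [Aa _ _]]] := ntA; exists a.
have clA := finite_dimensional_compact_closure cK dimX bA.
have [a [b [Aa Ab dab]]] := compact_diametral_pair supK A0 bA clA.
by apply: (diametral_pair_CCNF supK scX ntA bA cA _ _ dab) => p;
  exact: closure_le_farthest_distance.
Qed.

Lemma M_compact_strictly_convexP :
  strictly_convex X <->
  forall A : set X, nontrivial_set A -> bounded_set A -> centerable A ->
    M_compact A -> contains_chebyshev_center A -> CCNF A.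
Proof.
split=> [scX A ntA bA cA MA [c cc _]|H]; last first.
  apply: contrapT => /(not_strictly_convex_CCF supK).
  move=> [A [ntA bA cA [MA chA ccfA]]]; exact: H ccfA.
have A0 : A !=set0 by have [a [b [Aa _ _]]] := ntA; exists a.
have [|a [b [Aa Ab dab]]] := M_compact_diametral_pair supK A0 bA cA MA.
  by exists c.
by apply: (diametral_pair_CCNF supK scX ntA bA cA _ _ dab) => p;
  exact: le_farthest_distance.
Qed.

End characterizations.

Theorem theorem2p19 (R : realType) :
  [/\ (forall X : completeNormedModType R, has_dimension 2 X ->
        (strictly_convex X <->
         forall A : set X, nontrivial_set A -> bounded_set A ->
           contains_chebyshev_center A -> CCNF A)),
      (forall X : completeNormedModType R, finite_dimensional X ->
        (strictly_convex X <->
         forall A : set X, nontrivial_set A -> bounded_set A -> centerable A ->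
           contains_chebyshev_center A -> CCNF A))
      /\
      (forall X : completeNormedModType R[i], finite_dimensional X ->
        (strictly_convex X <->
         forall A : set X, nontrivial_set A -> bounded_set A -> centerable A ->
           contains_chebyshev_center A -> CCNF A)) &
      (forall X : completeNormedModType R,
        (strictly_convex X <->
         forall A : set X, nontrivial_set A -> bounded_set A -> centerable A ->
           M_compact A -> contains_chebyshev_center A -> CCNF A))
      /\
      (forall X : completeNormedModType R[i],
        (strictly_convex X <->
         forall A : set X, nontrivial_set A -> bounded_set A -> centerable A ->
           M_compact A -> contains_chebyshev_center A -> CCNF A))].
Proof.
split.
- move=> X dimX; split=> [scX A ntA bA _|H]; first exact: plane_CCNF.
  apply: contrapT => /(not_strictly_convex_CCF (@real_sup_complete R)).
  by move=> [A [ntA bA _ [_ chA ccfA]]]; exact: H ccfA.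
- split=> X dimX; apply: finite_dimensional_strictly_convexP => //.
  + exact: real_sup_complete.
  + exact: real_compact_unit_ball.
  + exact: complex_sup_complete.
  + exact: complex_compact_unit_ball.
- split=> X; apply: M_compact_strictly_convexP.
  + exact: real_sup_complete.
  + exact: complex_sup_complete.
Qed.
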